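(* For all integers $n \geq 1$ and $k \geq 1$, let $S_n^k = 1^k + 2^k + \cdots + n^k$. Then $$S_n^k = \frac{1}{k+1}\left( n^{k+1} + \frac{1}{2}\binom{k+1}{1} n^k + \sum_{i=2}^{k} \binom{k+1}{i} B_i\, n^{k+1-i} \right),$$ where $B_i$ denotes the $i$-th Bernoulli number and the sum over $i$ is empty (equal to $0$) when $k=1$.
   Context: The Bernoulli numbers $(B_n)_{n\ge 0}$ are the rational numbers defined recursively by $B_0 = 1$ and, for $n \geq 1$, $$B_n = \frac{-1}{n+1}\left( \binom{n+1}{0} B_0 + \binom{n+1}{1} B_1 + \cdots + \binom{n+1}{n-1} B_{n-1} \right).$$ In particular $B_1 = -\tfrac12$ and $B_2 = \tfrac16$. Here $\binom{m}{j}$ is the usual binomial coefficient. *)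

(* Defs.v *)
From mathcomp Require Import all_boot all_order all_algebra.

Set Implicit Arguments.
Unset Strict Implicit.
Unset Printing Implicit Defensive.

Import Order.TTheory GRing.Theory Num.Theory.
Local Open Scope ring_scope.

(* [:: B_0; ...; B_(m-1)]: the recursion for B_n uses all earlier values, so
   the whole initial segment is built; [bernoulliE] recovers the textbook
   recursion. *)
Fixpoint bernoulli_seq (m : nat) : seq rat :=
  if m is n.+1 then
    let s := bernoulli_seq n in
    rcons s (if n == 0%N then 1
             else (-1) / n.+1%:R * \sum_(j < n) 'C(n.+1, j)%:R * s`_j)
  else [::].

Definition bernoulli (n : nat) : rat := (bernoulli_seq n.+1)`_n.

Lemma size_bernoulli_seq m : size (bernoulli_seq m) = m.
Proof. by elim: m => //= m IHm; rewrite size_rcons IHm. Qed.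

Lemma nth_bernoulli_seq m j : (j < m)%N -> (bernoulli_seq m)`_j = bernoulli j.
Proof.
elim: m => // m IHm; rewrite ltnS leq_eqVlt => /predU1P[-> // | lt_jm].
by rewrite /= nth_rcons size_bernoulli_seq lt_jm IHm.
Qed.

Lemma bernoulli0 : bernoulli 0 = 1.
Proof. by []. Qed.

Lemma bernoulliE (n : nat) : (1 <= n)%N ->
  bernoulli n =
    (-1) / n.+1%:R * \sum_(0 <= j < n) 'C(n.+1, j)%:R * bernoulli j.
Proof.
case: n => // n _; rewrite {1}/bernoulli [bernoulli_seq n.+2]/=.
rewrite -/(bernoulli_seq n.+1) nth_rcons size_bernoulli_seq ltnn eqxx.
rewrite big_mkord; congr (_ * _); apply: eq_bigr => j _; congr (_ * _).
exact: nth_bernoulli_seq (ltn_ord j).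
Qed.

Lemma bernoulli1 : bernoulli 1 = - (1 / 2%:R).
Proof. by rewrite bernoulliE // big_nat1 bernoulli0. Qed.

Lemma bernoulli2 : bernoulli 2 = 1 / 6%:R.
Proof.
by rewrite bernoulliE // big_nat_recr // big_nat1 bernoulli0 bernoulli1.
Qed.

(* Main.v *)
Require Import Defs.
From mathcomp Require Import all_boot all_order all_algebra.
From mathcomp Require Import ring zify.

Set Implicit Arguments.
Unset Strict Implicit.
Unset Printing Implicit Defensive.

Import Order.TTheory GRing.Theory Num.Theory.
Local Open Scope ring_scope.

(** Put K = k + 1 and P(x) = sum of 'C(K, i) B_i x^(K - i) over i < K, the
    K-th Bernoulli polynomial without its constant term.  The recursion for
    the B_i says that the sum of 'C(m, i) B_i over i < m is 1 for m = 1 and 0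
    for m > 1 ([sum_bin_bernoulli]).  Expanding P(x + 1) - P(x) by the
    binomial theorem and using 'C(K, i) 'C(K - i, j) = 'C(K, j) 'C(K - j, i)
    ([mul_bin_subC]) to collect the coefficient of x^j produces exactly
    such a sum with m = K - j, so only j = k survives and
    P(x + 1) - P(x) = K x^k ([faulhaber_step]).  Telescoping from P(0) = 0
    gives K (0^k + ... + (n-1)^k) = P(n); adding K n^k changes the
    B_1 = -1/2 term of P into the +1/2 term of the formula. *)

Definition faulhaber (K : nat) (x : rat) : rat :=
  \sum_(0 <= i < K) 'C(K, i)%:R * bernoulli i * x ^+ (K - i).

Lemma sum_bin_bernoulli (m : nat) :
  \sum_(0 <= i < m.+1) 'C(m.+1, i)%:R * bernoulli i = (m == 0%N)%:R.
Proof.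
case: m => [|m]; first by rewrite big_nat1 bernoulli0 bin0 mulr1.
rewrite big_nat_recr //= [bernoulli m.+1]bernoulliE // binSn.
have nz : m.+2%:R != 0 :> rat by rewrite pnatr_eq0.
by rewrite mulrA mulrCA divff // mulr1 mulN1r subrr.
Qed.

(** Both sides are the multinomial coefficient counting disjoint pairs of an
    i-subset and a j-subset of a K-set. *)
Lemma mul_bin_subC (K i j : nat) : (i + j <= K)%N ->
  ('C(K, i) * 'C(K - i, j) = 'C(K, j) * 'C(K - j, i))%N.
Proof.
move=> le_ijK.
apply/eqP; rewrite -(eqn_pmul2r (_ : 0 < i`! * j`! * (K - i - j)`!)%N);
  last by rewrite !muln_gt0 !fact_gt0.
have bin_bin a b : (a + b <= K)%N ->
    ('C(K, a) * 'C(K - a, b) * (a`! * b`! * (K - a - b)`!) = K`!)%N.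
  move=> le_abK; rewrite -(@bin_fact K a); last by lia.
  by rewrite -(@bin_fact (K - a) b); [ring | lia].
rewrite bin_bin // [(i`! * _)%N]mulnC (_ : K - i - j = K - j - i)%N; last by lia.
by rewrite bin_bin // addnC.
Qed.

Lemma expr_succ_sub (x : rat) (m : nat) :
  (x + 1) ^+ m - x ^+ m = \sum_(0 <= j < m) 'C(m, j)%:R * x ^+ j.
Proof.
rewrite [x + 1]addrC exprDn big_ord_recr /= subnn binn expr0 mul1r mulr1n addrK.
rewrite big_mkord; apply: eq_bigr => j _.
by rewrite expr1n mul1r mulr_natl.
Qed.

Lemma faulhaber_step (k : nat) (x : rat) :
  faulhaber k.+1 (x + 1) - faulhaber k.+1 x = k.+1%:R * x ^+ k.
Proof.
rewrite /faulhaber -sumrB; set K := k.+1.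
transitivity (\sum_(0 <= i < K) \sum_(0 <= j < K | (i + j < K)%N)
                ('C(K, i) * 'C(K - i, j))%:R * bernoulli i * x ^+ j).
  apply: eq_big_nat => i /andP[_ lt_iK].
  rewrite -mulrBr expr_succ_sub (big_nat_widen _ _ K) ?leq_subr // big_distrr.
  apply: eq_big => [j|j _] /=; first by rewrite ltn_subRL.
  by rewrite natrM; ring.
rewrite (exchange_big_dep xpredT) //=.
transitivity (\sum_(0 <= j < K) 'C(K, j)%:R * x ^+ j * (j == k)%:R).
  apply: eq_big_nat => j /andP[_ lt_jK].
  have -> : (j == k) = ((k - j)%N == 0%N) by lia.
  rewrite -sum_bin_bernoulli -subSn // -/K big_distrr /=.
  rewrite [RHS](big_nat_widen _ _ K) ?leq_subr //.
  apply: eq_big => [i|i /ltnW le_ijK]; first by rewrite ltn_subRL addnC.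
  by rewrite mul_bin_subC // natrM; ring.
rewrite big_nat_recr //= eqxx mulr1 binSn big_nat big1 ?add0r // => j /andP[_ lt_jk].
by rewrite ltn_eqF // mulr0.
Qed.

Lemma sum_pow_faulhaber (k n : nat) :
  k.+1%:R * \sum_(0 <= m < n) (m%:R : rat) ^+ k = faulhaber k.+1 n%:R.
Proof.
elim: n => [|n IHn].
  rewrite big_geq // mulr0 /faulhaber big_nat big1 // => i /andP[_ lt_ik].
  by rewrite expr0n subn_eq0 leqNgt lt_ik mulr0.
rewrite big_nat_recr //= mulrDr IHn -faulhaber_step -natr1.
by rewrite addrC subrK.
Qed.

Theorem mainTheorem1 (n k : nat) (hn : (1 <= n)%N) (hk : (1 <= k)%N) :
  \sum_(1 <= m < n.+1) (m%:R : rat) ^+ k =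
    1 / (k.+1)%:R *
      (n%:R ^+ k.+1
       + 1 / 2%:R * 'C(k.+1, 1)%:R * n%:R ^+ k
       + \sum_(2 <= i < k.+1)
           'C(k.+1, i)%:R * bernoulli i * n%:R ^+ (k.+1 - i)).
Proof.
have nzK : k.+1%:R != 0 :> rat by rewrite pnatr_eq0.
(* As k >= 1, the term m = 0 vanishes, so the sum may start there. *)
have -> : \sum_(1 <= m < n.+1) (m%:R : rat) ^+ k
        = \sum_(0 <= m < n) (m%:R : rat) ^+ k + n%:R ^+ k.
  by rewrite -big_nat_recr //= [RHS]big_ltn // expr0n -[k == 0%N]negbK -lt0n hk add0r.
apply: (mulfI nzK); rewrite mulrDr sum_pow_faulhaber /faulhaber.
rewrite big_ltn // big_ltn // bernoulli0 bernoulli1 bin0 bin1 subn0 subSS subn0.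
by field; rewrite nat1r.
Qed.
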